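(* Let $T$ be a fixed right triangle (regarded as the set of its three vertices). For any positive integer $r$, we have $\mathbb{E}^{3}\overset{r}{\rightarrow} (T;T)_{\mathrm{GR}}$. That is, for every $r$-coloring of the points of $\mathbb{E}^3$ there is a monochromatic set congruent to $T$ or a rainbow set congruent to $T$.
   Context: $\mathbb{E}^n$ denotes $n$-dimensional Euclidean space. An $r$-coloring of $\mathbb{E}^n$ is an assignment to each point of one of $r$ colors (not all colors need be used). A set of points is monochromatic if all its points have the same color, and rainbow if its points have pairwise distinct colors. A configuration is a set of points in a Euclidean space; a triangle is identified with its set of three (non-collinear) vertices. A copy of a configuration $K$ is a set congruent (isometric) to $K$. The notation $\mathbb{E}^n\overset{r}{\rightarrow}(K_1;K_2)_{\mathrm{GR}}$ means that every $r$-coloring of $\mathbb{E}^n$ contains either a monochromatic set congruent to $K_1$ or a rainbow set congruent to $K_2$. *)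

(* Defs.v *)
From mathcomp Require Import all_boot all_order all_algebra.
From mathcomp Require Import boolp classical_sets functions reals.

Set Implicit Arguments.
Unset Strict Implicit.
Unset Printing Implicit Defensive.
Import Order.TTheory GRing.Theory Num.Theory.
Local Open Scope classical_set_scope.
Local Open Scope ring_scope.

(* Points of E^n are row vectors 'rV[R]_n. The norm that MathComp-Analysis puts
   on matrices is the sup norm, hence the explicit Euclidean structure. *)
Definition dotp (R : realType) (n : nat) (u v : 'rV[R]_n) : R :=
  \sum_(i < n) u 0 i * v 0 i.

Definition edist (R : realType) (n : nat) (x y : 'rV[R]_n) : R :=
  Num.sqrt (dotp (x - y) (x - y)).

(* K and L may live in Euclidean spaces of different dimensions. *)
Definition congruent (R : realType) (m n : nat)
    (K : set 'rV[R]_m) (L : set 'rV[R]_n) : Prop :=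
  exists f : 'rV[R]_m -> 'rV[R]_n,
    set_bij K L f /\
    (forall x y, K x -> K y -> edist (f x) (f y) = edist x y).

Definition collinear (R : realType) (n : nat) (a b c : 'rV[R]_n) : Prop :=
  exists p v : 'rV[R]_n,
    [set a; b; c] `<=` [set x | exists t : R, x = p + t *: v].

(* A triangle is identified with the set of its vertices; the right angle is at
   the vertex a. *)
Definition right_triangle (R : realType) (n : nat) (T : set 'rV[R]_n) : Prop :=
  exists a b c : 'rV[R]_n,
    [/\ T = [set a; b; c], ~ collinear a b c & dotp (b - a) (c - a) = 0].

Definition monochromatic (R : realType) (n r : nat)
    (chi : 'rV[R]_n -> 'I_r) (K : set 'rV[R]_n) : Prop :=
  forall x y, K x -> K y -> chi x = chi y.

Definition rainbow (R : realType) (n r : nat)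
    (chi : 'rV[R]_n -> 'I_r) (K : set 'rV[R]_n) : Prop :=
  forall x y, K x -> K y -> x <> y -> chi x <> chi y.

(* E^n --r--> (K1; K2)_GR. *)
Definition GR_arrow (R : realType) (n r m1 m2 : nat)
    (K1 : set 'rV[R]_m1) (K2 : set 'rV[R]_m2) : Prop :=
  forall chi : 'rV[R]_n -> 'I_r,
    (exists L : set 'rV[R]_n, congruent K1 L /\ monochromatic chi L) \/
    (exists L : set 'rV[R]_n, congruent K2 L /\ rainbow chi L).

(* Main.v *)
Require Import Defs.
From mathcomp Require Import all_boot all_order all_algebra.
From mathcomp Require Import boolp classical_sets functions reals.
From mathcomp Require Import ring lra.

(** Let [a] and [b] be the legs of [T], and suppose that a coloring of space
    has no monochromatic and no rainbow copy of [T]: every copy shows exactly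
    two colors.  A rectangle with sides [a] and [b] consists of four copies of
    [T], so its colors split two against two ([rect_mono], [rect_bichromatic]).

    Suppose that some segment of length [a], from [X] to [X + v], has both ends
    of one color, and let [P] be the plane through [X] orthogonal to [v].
    Moving the segment sideways by steps of length [b] keeps it monochromatic,
    and the color changes at each step.  Such steps reach all of [P]
    ([steps_reach_plane]), so in [P] any two points at distance [b] have
    different colors, and an equilateral triangle of side [b] shows that [P]
    has at least three colors ([proper_plane_not_bicolored]).  Look now at
    segments of length [b] orthogonal to [P].  If one of them had two colors,
    moving it by steps of length [a] would show that [P] has only these two
    colors.  So all of them are monochromatic, and then points of [P] at
    distance [a] have different colors as well.

    In such a plane the hypotenuse of every copy of [T] must be monochromatic,
    since the legs are not and the copy is not rainbow.  Hence the color does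
    not change along any vector of length [sqrt (a^2 + b^2)]; two such vectors
    add up to one of length [a], a contradiction ([no_doubly_proper_plane]).

    Therefore no segment of length [a] is monochromatic, nor, by symmetry, one
    of length [b] ([no_mono_leg]).  But then every plane gives the
    contradiction just described. *)

Set Implicit Arguments.
Unset Strict Implicit.
Unset Printing Implicit Defensive.
Import Order.TTheory GRing.Theory Num.Theory.
Local Open Scope classical_set_scope.
Local Open Scope ring_scope.

(** * The dot product and orthonormal frames *)

Lemma dotpC (R : realType) n (u v : 'rV[R]_n) : dotp u v = dotp v u.
Proof. by apply: eq_bigr => i _; rewrite mulrC. Qed.

Lemma dotpDl (R : realType) n (u v w : 'rV[R]_n) :
  dotp (u + v) w = dotp u w + dotp v w.
Proof. by rewrite -big_split; apply: eq_bigr => i _; rewrite mxE mulrDl. Qed.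

Lemma dotpZl (R : realType) n (k : R) (u v : 'rV[R]_n) :
  dotp (k *: u) v = k * dotp u v.
Proof. by rewrite /dotp mulr_sumr; apply: eq_bigr => i _; rewrite mxE mulrA. Qed.

Lemma dotpDr (R : realType) n (u v w : 'rV[R]_n) :
  dotp w (u + v) = dotp w u + dotp w v.
Proof. by rewrite dotpC dotpDl !(dotpC w). Qed.

Lemma dotpZr (R : realType) n (k : R) (u v : 'rV[R]_n) :
  dotp v (k *: u) = k * dotp v u.
Proof. by rewrite dotpC dotpZl dotpC. Qed.

Lemma dotpNl (R : realType) n (u v : 'rV[R]_n) : dotp (- u) v = - dotp u v.
Proof. by rewrite -scaleN1r dotpZl mulN1r. Qed.

Lemma dotpNr (R : realType) n (u v : 'rV[R]_n) : dotp v (- u) = - dotp v u.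
Proof. by rewrite dotpC dotpNl dotpC. Qed.

Lemma dotp_pythagoras (R : realType) n (u v : 'rV[R]_n) :
  dotp u v = 0 -> dotp (u - v) (u - v) = dotp u u + dotp v v.
Proof.
move=> uv; rewrite !(dotpDl, dotpDr, dotpNl, dotpNr) (dotpC v u) uv.
by ring.
Qed.

Lemma dotp_ge0 (R : realType) n (u : 'rV[R]_n) : 0 <= dotp u u.
Proof. by apply: sumr_ge0 => i _; rewrite -expr2 sqr_ge0. Qed.

Lemma dotp_eq0 (R : realType) n (u : 'rV[R]_n) : dotp u u = 0 -> u = 0.
Proof.
move=> /eqP; rewrite psumr_eq0; last by move=> i _; rewrite -expr2 sqr_ge0.
move=> /allP u0; apply/rowP => i; rewrite mxE.
by have /= := u0 i (mem_index_enum i); rewrite mulf_eq0 orbb => /eqP.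
Qed.

Lemma edist_eq0 (R : realType) n (x y : 'rV[R]_n) : edist x y = 0 -> x = y.
Proof.
move=> /eqP; rewrite sqrtr_eq0 => d0; apply/eqP; rewrite -subr_eq0; apply/eqP.
by apply: dotp_eq0; apply/eqP; rewrite eq_le d0 dotp_ge0.
Qed.

Definition orthonormal_pair (R : realType) n (e1 e2 : 'rV[R]_n) : Prop :=
  [/\ dotp e1 e1 = 1, dotp e2 e2 = 1 & dotp e1 e2 = 0].

Definition comb2 (R : realType) n (e1 e2 : 'rV[R]_n) (x y : R) : 'rV[R]_n :=
  x *: e1 + y *: e2.

Lemma comb2D (R : realType) n (e1 e2 : 'rV[R]_n) (x y u v : R) :
  comb2 e1 e2 (x + u) (y + v) = comb2 e1 e2 x y + comb2 e1 e2 u v.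
Proof. by rewrite /comb2 !scalerDl addrACA. Qed.

Lemma dotp_comb2 (R : realType) n (e1 e2 : 'rV[R]_n) (x y u v : R) :
  orthonormal_pair e1 e2 ->
  dotp (comb2 e1 e2 x y) (comb2 e1 e2 u v) = x * u + y * v.
Proof.
move=> [e11 e22 e12]; rewrite /comb2 !(dotpDl, dotpDr, dotpZl, dotpZr).
by rewrite (dotpC e2 e1) e11 e22 e12; ring.
Qed.

Lemma dotp_orth_comb2 (R : realType) n (v e1 e2 : 'rV[R]_n) (x y : R) :
  dotp v e1 = 0 -> dotp v e2 = 0 -> dotp v (comb2 e1 e2 x y) = 0.
Proof. by move=> v1 v2; rewrite dotpDr !dotpZr v1 v2 !mulr0 addr0. Qed.

Definition row3 (R : realType) (x y z : R) : 'rV[R]_3 :=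
  \row_(i < 3) [:: x; y; z]`_i.

Lemma row3_eta (R : realType) (v : 'rV[R]_3) : exists x y z, v = row3 x y z.
Proof.
exists (v 0 0), (v 0 1), (v 0 2); apply/rowP => i; rewrite mxE.
by case: i => [[|[|[|//]]] hi] /=; congr (v 0 _); apply: val_inj.
Qed.

Lemma dotp_row3 (R : realType) (x y z x' y' z' : R) :
  dotp (row3 x y z) (row3 x' y' z') = x * x' + y * y' + z * z'.
Proof. by rewrite /dotp !big_ord_recl big_ord0 !mxE /= addr0 addrA. Qed.

(** The second vector of the frame is the cross product of the normal [v] with
    the first one; its length is [1] by Lagrange's identity. *)
Lemma orthogonal_frame (R : realType) (v : 'rV[R]_3) :
  dotp v v = 1 ->
  exists e1 e2, [/\ orthonormal_pair e1 e2, dotp v e1 = 0 & dotp v e2 = 0].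
Proof.
have [x [y [z ->]]] := row3_eta v; rewrite dotp_row3 => v1.
have [p [q [s [e11 ve]]]] : exists p q s : R,
    p * p + q * q + s * s = 1 /\ x * p + y * q + z * s = 0.
  have [xy0|xyN0] := eqVneq (x ^+ 2 + y ^+ 2) 0.
    have x0 : x = 0 by nra.
    by exists 1, 0, 0; rewrite x0; split; ring.
  have xy_gt0 : 0 < x ^+ 2 + y ^+ 2 by rewrite lt_def xyN0 addr_ge0 ?sqr_ge0.
  set l := Num.sqrt (x ^+ 2 + y ^+ 2).
  have l2 : l ^+ 2 = x ^+ 2 + y ^+ 2 by rewrite sqr_sqrtr // ltW.
  have lN0 : l != 0 by rewrite gt_eqF // sqrtr_gt0.
  exists (- y / l), (x / l), 0; split; last by field.
  transitivity ((x ^+ 2 + y ^+ 2) / l ^+ 2); first by field.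
  by rewrite l2 divff.
exists (row3 p q s), (row3 (y * s - z * q) (z * p - x * s) (x * q - y * p)).
rewrite /orthonormal_pair !dotp_row3; split; [split=> //| by [] |]; try ring.
transitivity ((x * x + y * y + z * z) * (p * p + q * q + s * s)
              - (x * p + y * q + z * s) ^+ 2); first by ring.
by rewrite v1 e11 ve; ring.
Qed.

(** * Colorings of the plane *)

(** Cut the segment from [(x, y)] to [(x + t, y)] into equal pieces shorter
    than [2 * a]: each piece is the base of an isosceles triangle with two sides
    of length [a], and two steps along these sides cross it. *)
Lemma steps_reach_line (R : realType) (a : R) (S : R -> R -> Prop) :
  0 < a ->
  (forall x y u v, u ^+ 2 + v ^+ 2 = a ^+ 2 -> S x y -> S (x + u) (y + v)) ->
  forall x y t, S x y -> S (x + t) y.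
Proof.
move=> a0 step x y t Sxy.
pose k := Num.bound (`|t| / a).
have kgt : `|t| / a < k%:R by apply: archi_boundP; rewrite divr_ge0 // ltW.
have k0 : 0 < k%:R :> R by apply: le_lt_trans kgt; rewrite divr_ge0 // ltW.
pose d := t / (2 * k%:R).
have td : t = k%:R * (d + d) by rewrite /d; field; rewrite gt_eqF.
have da : d ^+ 2 <= a ^+ 2.
  rewrite -ler_sqrt ?sqr_ge0 // ?exprn_gt0 // !sqrtr_sqr (gtr0_norm a0).
  move: kgt; rewrite ltr_pdivrMr // td normrM (gtr0_norm k0) ltr_pM2l // => h.
  apply: ltW; apply: le_lt_trans h.
  by rewrite -mulr2n normrMn mulr2n lerDl.
have h2 : Num.sqrt (a ^+ 2 - d ^+ 2) ^+ 2 = a ^+ 2 - d ^+ 2.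
  by rewrite sqr_sqrtr // subr_ge0.
set h := Num.sqrt _ in h2.
suff Sj (j : nat) : S (x + j%:R * (d + d)) y by rewrite td.
elim: j => [|j IH]; first by rewrite mul0r addr0.
have -> : x + j.+1%:R * (d + d) = (x + j%:R * (d + d) + d) + d.
  by rewrite -natr1; ring.
have -> : y = (y + h) + - h by ring.
apply: (step); first by rewrite sqrrN h2; ring.
by apply: step => //; rewrite h2; ring.
Qed.

Lemma steps_reach_plane (R : realType) (a : R) (S : R -> R -> Prop) :
  0 < a ->
  (forall x y u v, u ^+ 2 + v ^+ 2 = a ^+ 2 -> S x y -> S (x + u) (y + v)) ->
  forall x0 y0 x y, S x0 y0 -> S x y.
Proof.
move=> a0 step x0 y0 x y S0.
have Sx : S x y0.
  by have := steps_reach_line a0 step (x - x0) S0; rewrite addrC subrK.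
have stepT x' y' u v : u ^+ 2 + v ^+ 2 = a ^+ 2 ->
    S y' x' -> S (y' + v) (x' + u).
  by move=> uv; apply: step; rewrite addrC.
have := @steps_reach_line R a (fun x y => S y x) a0 stepT y0 x (y - y0) Sx.
by rewrite addrC subrK.
Qed.

(** Witness: an equilateral triangle with side [b]. *)
Lemma proper_plane_not_bicolored (R : realType) (C : Type) (b : R)
    (g : R -> R -> C) (c1 c2 : C) :
  (forall x y u v, u ^+ 2 + v ^+ 2 = b ^+ 2 -> g x y <> g (x + u) (y + v)) ->
  ~ (forall x y, g x y = c1 \/ g x y = c2).
Proof.
move=> gb g12.
have s3 : Num.sqrt 3 ^+ 2 = 3 :> R by rewrite sqr_sqrtr.
set s := Num.sqrt 3 in s3.
have h0 : g 0 0 <> g (0 + b) (0 + 0) by apply: gb; ring.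
have h1 : g 0 0 <> g (0 + b / 2) (0 + b * s / 2).
  by apply: gb; rewrite !exprMn s3; field.
have h2 : g (0 + b) (0 + 0) <> g (0 + b + - (b / 2)) (0 + 0 + b * s / 2).
  by apply: gb; rewrite sqrrN !exprMn s3; field.
have e1 : 0 + b + - (b / 2) = 0 + b / 2 by field.
have e2 : 0 + 0 + b * s / 2 = 0 + b * s / 2 by ring.
rewrite e1 e2 in h2.
by move: h0 h1 h2; case: (g12 0 0) => ->; case: (g12 (0 + b) (0 + 0)) => ->;
  case: (g12 (0 + b / 2) (0 + b * s / 2)) => ->.
Qed.

(** If neither leg of a right triangle is ever monochromatic, then each
    hypotenuse is, and the apex of the isosceles triangle with base [a] and two
    sides of the length of the hypotenuse forces a monochromatic base. *)
Lemma no_doubly_proper_plane (R : realType) (C : Type) (a b : R)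
    (g : R -> R -> C) :
  0 < a -> 0 < b ->
  (forall x y u v, u ^+ 2 + v ^+ 2 = a ^+ 2 -> g x y <> g (x + u) (y + v)) ->
  (forall x y u v, u ^+ 2 + v ^+ 2 = b ^+ 2 -> g x y <> g (x + u) (y + v)) ->
  (forall x y u1 u2 w1 w2,
     u1 ^+ 2 + u2 ^+ 2 = a ^+ 2 -> w1 ^+ 2 + w2 ^+ 2 = b ^+ 2 ->
     u1 * w1 + u2 * w2 = 0 ->
     [\/ g x y = g (x + u1) (y + u2), g x y = g (x + w1) (y + w2)
       | g (x + u1) (y + u2) = g (x + w1) (y + w2)]) ->
  False.
Proof.
move=> a0 b0 ga gb g3.
pose c2 := a ^+ 2 + b ^+ 2.
have c2N0 : c2 != 0 by rewrite gt_eqF // addr_gt0 // exprn_gt0.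
have hyp x y d1 d2 : d1 ^+ 2 + d2 ^+ 2 = c2 -> g x y = g (x + d1) (y + d2).
  move=> dc.
  (* The foot of the altitude divides the hypotenuse in the ratio a^2 : b^2,
     and the altitude is a b / c: [u] and [u + d] are the two legs. *)
  pose u1 := - (a ^+ 2 / c2) * d1 + a * b / c2 * (- d2).
  pose u2 := - (a ^+ 2 / c2) * d2 + a * b / c2 * d1.
  have uu : u1 ^+ 2 + u2 ^+ 2 = a ^+ 2.
    transitivity ((d1 ^+ 2 + d2 ^+ 2) * a ^+ 2 * c2 / c2 ^+ 2).
      by rewrite /u1 /u2 /c2; field.
    by rewrite dc; field.
  have ww : (u1 + d1) ^+ 2 + (u2 + d2) ^+ 2 = b ^+ 2.
    transitivity ((d1 ^+ 2 + d2 ^+ 2) * b ^+ 2 * c2 / c2 ^+ 2).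
      by rewrite /u1 /u2 /c2; field.
    by rewrite dc; field.
  have uw : u1 * (u1 + d1) + u2 * (u2 + d2) = 0.
    by rewrite /u1 /u2 /c2; field.
  have e1 : x - u1 + (u1 + d1) = x + d1 by rewrite addrA subrK.
  have e2 : y - u2 + (u2 + d2) = y + d2 by rewrite addrA subrK.
  have na := ga (x - u1) (y - u2) _ _ uu.
  have nb := gb (x - u1) (y - u2) _ _ ww.
  by case: (g3 (x - u1) (y - u2) _ _ _ _ uu ww uw) => //; rewrite e1 e2 !subrK.
pose h := Num.sqrt (c2 - (a / 2) ^+ 2).
have h2 : h ^+ 2 = c2 - (a / 2) ^+ 2.
  by rewrite sqr_sqrtr // /c2; nra.
apply: (ga 0 0 a 0); first by ring.
rewrite (hyp 0 0 (a / 2) h); last by rewrite h2; ring.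
rewrite (hyp _ _ (a / 2) (- h)); last by rewrite sqrrN h2; ring.
by congr g; field.
Qed.

(** * Colorings without monochromatic or rainbow right triangles *)

Definition bicolors_right_triangles (R : realType) n (C : Type)
    (chi : 'rV[R]_n -> C) (a b : R) : Prop :=
  forall x u w, dotp u u = a ^+ 2 -> dotp w w = b ^+ 2 -> dotp u w = 0 ->
    ~ (chi x = chi (x + u) /\ chi x = chi (x + w)) /\
    [\/ chi x = chi (x + u), chi x = chi (x + w) | chi (x + u) = chi (x + w)].

Lemma bicolors_right_trianglesC (R : realType) n (C : Type)
    (chi : 'rV[R]_n -> C) (a b : R) :
  bicolors_right_triangles chi a b -> bicolors_right_triangles chi b a.
Proof.
move=> H x u w ub wa uw; have [] := H x w u wa ub _; first by rewrite dotpC.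
by move=> h1 h2; split; [tauto|case: h2; [constructor 2|constructor 1|constructor 3]].
Qed.

(** Three corners of the rectangle form a right triangle with legs [a] and [b],
    so no color occurs on three of the corners, and no three corners have
    different colors: one color on a side forces another one, twice, on the
    opposite side. *)
Lemma rect_mono (R : realType) n (C : Type) (chi : 'rV[R]_n -> C) (a b : R) :
  bicolors_right_triangles chi a b ->
  forall x u w, dotp u u = a ^+ 2 -> dotp w w = b ^+ 2 -> dotp u w = 0 ->
  chi x = chi (x + u) ->
  chi x <> chi (x + w) /\ chi (x + w) = chi (x + w + u).
Proof.
move=> H x u w uu ww uw xu.
have uu' : dotp (- u) (- u) = a ^+ 2 by rewrite dotpNl dotpNr opprK.
have ww' : dotp (- w) (- w) = b ^+ 2 by rewrite dotpNl dotpNr opprK.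
have uw' : dotp (- u) w = 0 by rewrite dotpNl uw oppr0.
have uw'' : dotp u (- w) = 0 by rewrite dotpNr uw oppr0.
have [nm _] := H x u w uu ww uw.
have [nm' _] := H (x + u) (- u) w uu' ww uw'.
have [nm'' r] := H (x + w) u (- w) uu ww' uw''.
rewrite !addrK !(addrAC x u w) in nm' nm'' r *.
have xw : chi x <> chi (x + w) by tauto.
split=> //; case: r => // r; first by case: xw.
by case: nm'; rewrite -xu r.
Qed.

(** Two colors on a side recur on the opposite side, in one order or the other.
    If the opposite side had one color, so would the given side, by
    [rect_mono]. *)
Lemma rect_bichromatic (R : realType) n (C : Type) (chi : 'rV[R]_n -> C)
    (a b : R) :
  bicolors_right_triangles chi a b ->
  forall x u w, dotp u u = a ^+ 2 -> dotp w w = b ^+ 2 -> dotp u w = 0 ->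
  chi x <> chi (x + u) ->
  [/\ chi (x + w) = chi x \/ chi (x + w) = chi (x + u),
      chi (x + w + u) = chi x \/ chi (x + w + u) = chi (x + u)
    & chi (x + w) <> chi (x + w + u)].
Proof.
move=> H x u w uu ww uw xu.
have uu' : dotp (- u) (- u) = a ^+ 2 by rewrite dotpNl dotpNr opprK.
have ww' : dotp (- w) (- w) = b ^+ 2 by rewrite dotpNl dotpNr opprK.
have uw' : dotp (- u) w = 0 by rewrite dotpNl uw oppr0.
have uw'' : dotp u (- w) = 0 by rewrite dotpNr uw oppr0.
have [_ r] := H x u w uu ww uw.
have [_ r'] := H (x + u) (- u) w uu' ww uw'.
rewrite !addrK !(addrAC x u w) in r' *.
split.
- by case: r => // ->; tauto.
- by case: r' => // h; [case: xu|right|left].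
move=> e.
by have [_] := rect_mono H uu ww' uw'' e; rewrite !addrK.
Qed.

(** This is the step from a monochromatic leg to a plane in which points at
    distance [a], and points at distance [b], always have different colors. *)
Lemma no_mono_leg (R : realType) (C : Type) (chi : 'rV[R]_3 -> C) (a b : R) :
  0 < a -> 0 < b -> bicolors_right_triangles chi a b ->
  forall x v, dotp v v = a ^+ 2 -> chi x <> chi (x + v).
Proof.
move=> a0 b0 H x v vv xv.
have H' := bicolors_right_trianglesC H.
pose e := a^-1 *: v.
have ee : dotp e e = 1.
  by rewrite dotpZl dotpZr vv; field; rewrite gt_eqF.
have [e1 [e2 [E ee1 ee2]]] := orthogonal_frame ee.
have ve : v = a *: e by rewrite scalerA divff ?scale1r ?gt_eqF.
(* [P] parametrizes the plane through [x] orthogonal to the segment. *)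
pose P s t := x + comb2 e1 e2 s t.
have PD s t p q : P (s + p) (t + q) = P s t + comb2 e1 e2 p q.
  by rewrite /P comb2D addrA.
have flat p q (l : R) : p ^+ 2 + q ^+ 2 = l ^+ 2 ->
    dotp (comb2 e1 e2 p q) (comb2 e1 e2 p q) = l ^+ 2.
  by rewrite dotp_comb2.
have vert k p q : dotp (k *: e) (comb2 e1 e2 p q) = 0.
  by rewrite dotpZl dotp_orth_comb2 ?mulr0.
have vvert p q : dotp v (comb2 e1 e2 p q) = 0 by rewrite ve vert.
have lenZ k : dotp (k *: e) (k *: e) = k ^+ 2.
  by rewrite dotpZl dotpZr ee; ring.
have leg_mono s t : chi (P s t) = chi (P s t + v).
  apply: (steps_reach_plane (a := b) b0 _ (x0 := 0) (y0 := 0)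
    (S := fun s t => chi (P s t) = chi (P s t + v))).
    move=> {}s {}t p q pq st; rewrite PD.
    by have [_] := rect_mono H vv (flat _ _ _ pq) (vvert _ _) st.
  by rewrite /P /comb2 !scale0r !addr0.
have b_proper s t p q : p ^+ 2 + q ^+ 2 = b ^+ 2 ->
    chi (P s t) <> chi (P (s + p) (t + q)).
  move=> pq; rewrite PD.
  by have [] := rect_mono H vv (flat _ _ _ pq) (vvert _ _) (leg_mono s t).
have normal_mono s t : chi (P s t) = chi (P s t + b *: e).
  apply: contrapT => bi.
  (* A single bichromatic segment would leave only two colors for the plane:
     moved by steps of length [a] it keeps its pair of colors. *)
  pose two c := c = chi (P s t) \/ c = chi (P s t + b *: e).
  apply: (proper_plane_not_bicolored b_proper (c1 := chi (P s t))
    (c2 := chi (P s t + b *: e))) => p q.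
  pose S p q := [/\ two (chi (P p q)), two (chi (P p q + b *: e))
    & chi (P p q) <> chi (P p q + b *: e)].
  suff [] : S p q by [].
  apply: (steps_reach_plane (a := a) (S := S) a0 _ (x0 := s) (y0 := t));
    last first.
    by split=> //; [left|right].
  move=> {}p {}q u w uw [h1 h2 h3]; rewrite /S PD.
  have [k1 k2 k3] := rect_bichromatic H' (lenZ b) (flat _ _ _ uw) (vert _ _ _) h3.
  by split=> //; [case: k1|case: k2] => ->.
apply: (no_doubly_proper_plane (g := fun s t => chi (P s t)) a0 b0 _ b_proper).
  move=> s t p q pq; rewrite PD.
  by have [] := rect_mono H' (lenZ b) (flat _ _ _ pq) (vert _ _ _)
    (normal_mono s t).
move=> s t u1 u2 w1 w2 uu ww uw; rewrite !PD.
have uw' : dotp (comb2 e1 e2 u1 u2) (comb2 e1 e2 w1 w2) = 0.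
  by rewrite dotp_comb2.
by have [] := H (P s t) _ _ (flat _ _ _ uu) (flat _ _ _ ww) uw'.
Qed.

Lemma no_bicolored_space (R : realType) (C : Type) (chi : 'rV[R]_3 -> C)
    (a b : R) :
  0 < a -> 0 < b -> ~ bicolors_right_triangles chi a b.
Proof.
move=> a0 b0 H.
have chia := no_mono_leg a0 b0 H.
have chib := no_mono_leg b0 a0 (bicolors_right_trianglesC H).
have [|e1 [e2 [E _ _]]] := @orthogonal_frame R (row3 1 0 0).
  by rewrite dotp_row3; ring.
apply: (no_doubly_proper_plane (g := fun s t => chi (comb2 e1 e2 s t)) a0 b0).
- by move=> s t p q pq; rewrite comb2D; apply: chia; rewrite dotp_comb2.
- by move=> s t p q pq; rewrite comb2D; apply: chib; rewrite dotp_comb2.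
move=> s t u1 u2 w1 w2 uu ww uw; rewrite !comb2D.
by apply: (H _ (comb2 e1 e2 u1 u2) (comb2 e1 e2 w1 w2) _ _ _).2;
  rewrite dotp_comb2.
Qed.

(** * Copies of a right triangle *)

Lemma not_collinear_neq (R : realType) n (p q s : 'rV[R]_n) :
  ~ collinear p q s -> q <> p /\ s <> p.
Proof.
move=> nc; split=> e; apply: nc; rewrite e.
  exists p, (s - p) => _ [[->|->]|->] /=.
  - by exists 0; rewrite scale0r addr0.
  - by exists 0; rewrite scale0r addr0.
  - by exists 1; rewrite scale1r addrC subrK.
exists p, (q - p) => _ [[->|->]|->] /=.
- by exists 0; rewrite scale0r addr0.
- by exists 1; rewrite scale1r addrC subrK.
- by exists 0; rewrite scale0r addr0.
Qed.

Lemma edistC (R : realType) n (x y : 'rV[R]_n) : edist x y = edist y x.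
Proof. by rewrite /edist -opprB dotpNl dotpNr opprK. Qed.

Lemma edistxx (R : realType) n (x : 'rV[R]_n) : edist x x = 0.
Proof. by rewrite /edist subrr -(scale0r x) dotpZl mul0r sqrtr0. Qed.

(** Side-angle-side. *)
Lemma congruent_right_triangle (R : realType) m n (p q s : 'rV[R]_m)
    (x u w : 'rV[R]_n) :
  q <> p -> s <> p ->
  dotp (q - p) (s - p) = 0 -> dotp u w = 0 ->
  dotp u u = dotp (q - p) (q - p) -> dotp w w = dotp (s - p) (s - p) ->
  congruent [set p; q; s] [set x; x + u; x + w].
Proof.
move=> qp sp qps uw uu ww.
have sq : s <> q.
  move=> e; apply: qp; apply/eqP; rewrite -subr_eq0; apply/eqP/dotp_eq0.
  by rewrite -{2}e.
pose f z := if z == p then x else if z == q then x + u else x + w.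
have fp : f p = x by rewrite /f eqxx.
have fq : f q = x + u by rewrite /f eqxx; move/eqP/negbTE: qp => ->.
have fs : f s = x + w.
  by rewrite /f; move/eqP/negbTE: sp => ->; move/eqP/negbTE: sq => ->.
have dpq : edist (x + u) x = edist q p by rewrite /edist addrAC subrr add0r uu.
have dps : edist (x + w) x = edist s p by rewrite /edist addrAC subrr add0r ww.
have dqs : edist (x + u) (x + w) = edist q s.
  rewrite /edist.
  have -> : x + u - (x + w) = u - w by rewrite opprD addrACA subrr add0r.
  have -> : q - s = (q - p) - (s - p) by rewrite opprB addrA subrK.
  by rewrite (dotp_pythagoras uw) (dotp_pythagoras qps) uu ww.
have fiso y z : [set p; q; s] y -> [set p; q; s] z ->
    edist (f y) (f z) = edist y z.
  move=> [[->|->]|->] [[->|->]|->]; rewrite ?fp ?fq ?fs ?edistxx //.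
  - by rewrite edistC dpq edistC.
  - by rewrite edistC dps edistC.
  - by rewrite edistC dqs edistC.
exists f; split=> //; split.
- by move=> _ [[->|->]|->] /=; rewrite ?fp ?fq ?fs; [left; left|left; right|right].
- move=> y z /set_mem Ky /set_mem Kz fyz; apply: edist_eq0.
  by rewrite -fiso // fyz edistxx.
- move=> _ [[->|->]|->] /=.
  + by exists p => //; left; left.
  + by exists q => //; left; right.
  + by exists s => //; right.
Qed.

Theorem theorem1p2 (R : realType) (m : nat) (T : set 'rV[R]_m)
    (hT : right_triangle T) (r : nat) (hr : (0 < r)%N) :
  GR_arrow 3 r T T.
Proof.
case: hT => p [q [s [-> nc qps]]] chi.
have [qp sp] := not_collinear_neq nc.
apply: contrapT => /not_orP[no_mono no_rainbow].
have pos z : z <> p -> 0 < edist z p.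
  move=> zp; rewrite lt_def sqrtr_ge0 andbT; apply/eqP => /edist_eq0.
  exact: zp.
have sq z : edist z p ^+ 2 = dotp (z - p) (z - p).
  by rewrite sqr_sqrtr // dotp_ge0.
apply: (no_bicolored_space (chi := chi) (pos q qp) (pos s sp)).
move=> x u w; rewrite !sq => uu ww uw.
have cong := congruent_right_triangle x qp sp qps uw uu ww.
split.
  move=> [xu xw]; apply: no_mono; exists [set x; x + u; x + w]; split=> //.
  by move=> y z [[->|->]|->] [[->|->]|->]; rewrite -?xu -?xw.
apply: contrapT => no_pair; apply: no_rainbow.
exists [set x; x + u; x + w]; split=> // y z.
have [xu xw uw'] : [/\ chi x <> chi (x + u), chi x <> chi (x + w)
    & chi (x + u) <> chi (x + w)].
  by split=> e; apply: no_pair; [constructor 1|constructor 2|constructor 3].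
by move=> [[->|->]|->] [[->|->]|->] // _ e; auto.
Qed.
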